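(* Consistency in $\mathcal{SSCC}$ is undecidable, even if the numerical constraints occurring in the TBox contain no transitive roles and no constants other than $0$ or $1$.
   Context: QFBAPA constraints: set constraints $s\subseteq t$, $s=t$ over set terms built from set variables, $\emptyset$, $\mathcal{U}$ using $\cap,\cup,{}^c$; numerical constraints $\ell=\ell'$, $\ell<\ell'$, $n\mathrel{\mathsf{div}}\ell$ over PA expressions $n_0+n_1|s_1|+\dots+n_k|s_k|$ ($n_i\in\mathbb{N}$). $\mathcal{ALCSCC}$ concepts are concept names $A$, $\neg C$, $C\sqcap D$ and $\mathsf{succ}(\mathfrak{con})$ with $\mathfrak{con}$ a set or numerical constraint whose set variables are role names and concepts. Interpretations must be finitely branching (each $d$ has finitely many role successors $\mathsf{ars}^\mathcal{I}(d)=\bigcup_r r^\mathcal{I}(d)$); $d\in\mathsf{succ}(\mathfrak{con})^\mathcal{I}$ iff $\mathfrak{con}$ holds under $\mathcal{U}\mapsto\mathsf{ars}^\mathcal{I}(d)$, $r\mapsto r^\mathcal{I}(d)$, $C\mapsto C^\mathcal{I}\cap\mathsf{ars}^\mathcal{I}(d)$. $\mathcal{SSCC}$ extends $\mathcal{ALCSCC}$ with transitivity axioms $\mathsf{trans}(r)$ in the TBox (a finite set of CIs $C\sqsubseteq D$ and transitivity axioms), requiring $r^\mathcal{I}$ to be transitive in models; a role name is transitive if it occurs in such an axiom. A TBox is consistent if it has a finitely branching model. ''No constants other than 0 or 1'' means all natural-number constants and coefficients in numerical constraints are $0$ or $1$. *)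

(* Defs.v *)
From mathcomp Require Import all_boot finmap.
From mathcomp Require Import boolp classical_sets functions cardinality.

Set Implicit Arguments.
Unset Strict Implicit.
Unset Printing Implicit Defensive.

Local Open Scope classical_set_scope.

(** * Syntax *)

(* Concept names and role names are two disjoint copies of [nat]. *)
Inductive concept : Type :=
  | CName of nat
  | CNot of concept
  | CAnd of concept & concept
  | CSucc of constraint
with constraint : Type :=
  | SubC of sterm & sterm
  | EqC of sterm & sterm
  | NumEq of pexpr & pexpr
  | NumLt of pexpr & pexpr
  | NumDiv of nat & pexpr
with sterm : Type :=
  | SRole of nat
  | SConcept of concept
  | SEmpty
  | SUniv
  | SCap of sterm & sterm
  | SCup of sterm & sterm
  | SCompl of sterm
(* [PAdd l n s] is l + n|s|, so that n0 + n1|s1| + ... + nk|sk| is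
   PAdd (... (PAdd (PConst n0) n1 s1) ...) nk sk. *)
with pexpr : Type :=
  | PConst of nat
  | PAdd of pexpr & nat & sterm.

Inductive axiom : Type :=
  | CI of concept & concept
  | Trans of nat.

Definition tbox := seq axiom.

(** * Semantics *)

Record interp := Interp {
  dom : Type;
  dom_inhabited : inhabited dom;
  cname : nat -> set dom;
  role : nat -> dom -> set dom  (* [role r d] is the set of r-successors of d *)
}.

(* The union ranges over all role names, not only those of a given TBox. *)
Definition ars (I : interp) (d : dom I) : set (dom I) :=
  \bigcup_r role r d.

Definition finitely_branching (I : interp) := forall d : dom I, finite_set (ars d).

(* Number of elements of a finite set ([{classic T}] is [T] with the choice
   structure that [fset_set] needs); 0 on infinite sets, which do not arise
   below when the interpretation is finitely branching. *)
Definition card (T : Type) (A : set T) : nat := #|` fset_set (A : set {classic T})|%fset.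

Fixpoint cext (I : interp) (C : concept) : set (dom I) :=
  match C with
  | CName A => cname A
  | CNot D => ~` (@cext I D)
  | CAnd D E => @cext I D `&` @cext I E
  | CSucc c => [set d | holds d c]
  end
with holds (I : interp) (d : dom I) (c : constraint) : Prop :=
  match c with
  | SubC s t => sext d s `<=` sext d t
  | EqC s t => sext d s = sext d t
  | NumEq l l' => pval d l = pval d l'
  | NumLt l l' => pval d l < pval d l'
  | NumDiv n l => n %| pval d l
  end
with sext (I : interp) (d : dom I) (s : sterm) : set (dom I) :=
  match s with
  | SRole r => role r d
  | SConcept C => @cext I C `&` ars d
  | SEmpty => set0
  | SUniv => ars d
  | SCap s1 s2 => sext d s1 `&` sext d s2
  | SCup s1 s2 => sext d s1 `|` sext d s2
  | SCompl s1 => ars d `\` sext d s1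
  end
with pval (I : interp) (d : dom I) (l : pexpr) : nat :=
  match l with
  | PConst n => n
  | PAdd l1 n s => pval d l1 + n * card (sext d s)
  end.

Definition sat_axiom (I : interp) (a : axiom) : Prop :=
  match a with
  | CI C D => @cext I C `<=` @cext I D
  | Trans r => forall x y z : dom I, role r x y -> role r y z -> role r x z
  end.

Definition model (I : interp) (T : tbox) : Prop :=
  foldr (fun a P => sat_axiom I a /\ P) True T.

Definition consistent (T : tbox) : Prop :=
  exists I : interp, finitely_branching I /\ model I T.

(** * The syntactic restriction *)

Definition transitive_roles (T : tbox) : seq nat :=
  pmap (fun a => if a is Trans r then Some r else None) T.

(* All occurrences count, including those inside nested concepts. *)
Fixpoint concept_roles (C : concept) : seq nat :=
  match C with
  | CName _ => [::]
  | CNot D => concept_roles D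
  | CAnd D E => concept_roles D ++ concept_roles E
  | CSucc c => constraint_roles c
  end
with constraint_roles (c : constraint) : seq nat :=
  match c with
  | SubC s t | EqC s t => sterm_roles s ++ sterm_roles t
  | NumEq l l' | NumLt l l' => pexpr_roles l ++ pexpr_roles l'
  | NumDiv _ l => pexpr_roles l
  end
with sterm_roles (s : sterm) : seq nat :=
  match s with
  | SRole r => [:: r]
  | SConcept C => concept_roles C
  | SEmpty | SUniv => [::]
  | SCap s1 s2 | SCup s1 s2 => sterm_roles s1 ++ sterm_roles s2
  | SCompl s1 => sterm_roles s1
  end
with pexpr_roles (l : pexpr) : seq nat :=
  match l with
  | PConst _ => [::]
  | PAdd l1 _ s => pexpr_roles l1 ++ sterm_roles s
  end.

Fixpoint pexpr_consts (l : pexpr) : seq nat :=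
  match l with
  | PConst n => [:: n]
  | PAdd l1 n _ => n :: pexpr_consts l1
  end.

(* The constants of [c] itself; those of constraints nested inside [c] are
   accounted for because [concept_nums] also lists the nested constraints. *)
Definition constraint_consts (c : constraint) : seq nat :=
  match c with
  | SubC _ _ | EqC _ _ => [::]
  | NumEq l l' | NumLt l l' => pexpr_consts l ++ pexpr_consts l'
  | NumDiv n l => n :: pexpr_consts l
  end.

Fixpoint concept_nums (C : concept) : seq constraint :=
  match C with
  | CName _ => [::]
  | CNot D => concept_nums D
  | CAnd D E => concept_nums D ++ concept_nums E
  | CSucc c => constraint_nums c
  end
with constraint_nums (c : constraint) : seq constraint :=
  match c with
  | SubC s t | EqC s t => sterm_nums s ++ sterm_nums t
  | NumEq l l' | NumLt l l' => c :: pexpr_nums l ++ pexpr_nums l'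
  | NumDiv _ l => c :: pexpr_nums l
  end
with sterm_nums (s : sterm) : seq constraint :=
  match s with
  | SRole _ | SEmpty | SUniv => [::]
  | SConcept C => concept_nums C
  | SCap s1 s2 | SCup s1 s2 => sterm_nums s1 ++ sterm_nums s2
  | SCompl s1 => sterm_nums s1
  end
with pexpr_nums (l : pexpr) : seq constraint :=
  match l with
  | PConst _ => [::]
  | PAdd l1 _ s => pexpr_nums l1 ++ sterm_nums s
  end.

Definition axiom_nums (a : axiom) : seq constraint :=
  if a is CI C D then concept_nums C ++ concept_nums D else [::].

Definition tbox_nums (T : tbox) : seq constraint := flatten (map axiom_nums T).

Definition no_transitive_roles_in_nums (T : tbox) : bool :=
  all (fun c => all (fun r => r \notin transitive_roles T) (constraint_roles c))
      (tbox_nums T).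

Definition only_01_constants (T : tbox) : bool :=
  all (fun c => all (fun n => n <= 1) (constraint_consts c)) (tbox_nums T).

Definition restricted (T : tbox) : bool :=
  no_transitive_roles_in_nums T && only_01_constants T.

(** * Goedel numbering *)

(* [CodeSeq.code] is a computable bijection between [seq nat] and [nat]; a node
   of a syntax tree is coded as the list of its tag and its children's codes. *)
Fixpoint code_concept (C : concept) : nat :=
  match C with
  | CName A => CodeSeq.code [:: 0; A]
  | CNot D => CodeSeq.code [:: 1; code_concept D]
  | CAnd D E => CodeSeq.code [:: 2; code_concept D; code_concept E]
  | CSucc c => CodeSeq.code [:: 3; code_constraint c]
  end
with code_constraint (c : constraint) : nat :=
  match c with
  | SubC s t => CodeSeq.code [:: 0; code_sterm s; code_sterm t]
  | EqC s t => CodeSeq.code [:: 1; code_sterm s; code_sterm t]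
  | NumEq l l' => CodeSeq.code [:: 2; code_pexpr l; code_pexpr l']
  | NumLt l l' => CodeSeq.code [:: 3; code_pexpr l; code_pexpr l']
  | NumDiv n l => CodeSeq.code [:: 4; n; code_pexpr l]
  end
with code_sterm (s : sterm) : nat :=
  match s with
  | SRole r => CodeSeq.code [:: 0; r]
  | SConcept C => CodeSeq.code [:: 1; code_concept C]
  | SEmpty => CodeSeq.code [:: 2]
  | SUniv => CodeSeq.code [:: 3]
  | SCap s1 s2 => CodeSeq.code [:: 4; code_sterm s1; code_sterm s2]
  | SCup s1 s2 => CodeSeq.code [:: 5; code_sterm s1; code_sterm s2]
  | SCompl s1 => CodeSeq.code [:: 6; code_sterm s1]
  end
with code_pexpr (l : pexpr) : nat :=
  match l with
  | PConst n => CodeSeq.code [:: 0; n]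
  | PAdd l1 n s => CodeSeq.code [:: 1; code_pexpr l1; n; code_sterm s]
  end.

Definition code_axiom (a : axiom) : nat :=
  match a with
  | CI C D => CodeSeq.code [:: 0; code_concept C; code_concept D]
  | Trans r => CodeSeq.code [:: 1; r]
  end.

Definition code_tbox (T : tbox) : nat := CodeSeq.code (map code_axiom T).

Scheme concept_mut := Induction for concept Sort Prop
  with constraint_mut := Induction for constraint Sort Prop
  with sterm_mut := Induction for sterm Sort Prop
  with pexpr_mut := Induction for pexpr Sort Prop.
Combined Scheme syntax_mut from concept_mut, constraint_mut, sterm_mut, pexpr_mut.

Lemma code_syntax_inj :
  [/\ injective code_concept, injective code_constraint,
      injective code_sterm & injective code_pexpr].
Proof.
suff [? [? [? ?]]] :
  (forall C D, code_concept C = code_concept D -> C = D) /\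
  (forall c d, code_constraint c = code_constraint d -> c = d) /\
  (forall s t, code_sterm s = code_sterm t -> s = t) /\
  (forall l m, code_pexpr l = code_pexpr m -> l = m) by split.
apply: syntax_mut => *;
  match goal with H : _ = ?f ?y |- _ = ?y =>
    destruct y; move/(can_inj CodeSeq.codeK): H => // H; injection H
  end; intros; f_equal; auto.
Qed.

Lemma code_tbox_inj : injective code_tbox.
Proof.
have [injC _ _ _] := code_syntax_inj.
apply/(inj_comp (can_inj CodeSeq.codeK))/inj_map.
by case=> [C D|r] [C' D'|r'] /(can_inj CodeSeq.codeK) // [];
  [move=> /injC-> /injC-> | move=> ->].
Qed.

(** * Computability *)

(* Register machines (Shepherdson-Sturgis, Minsky) with unboundedly many
   registers, which compute exactly the partial recursive functions.
   [DecJump i j] jumps to instruction j if register i is 0; otherwise it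
   decrements register i and moves on to the next instruction. *)
Inductive instr : Type :=
  | Incr of nat
  | DecJump of nat & nat.

Definition program := seq instr.

Definition config := (nat * (nat -> nat))%type.

Definition set_reg (reg : nat -> nat) (i v : nat) : nat -> nat :=
  fun j => if j == i then v else reg j.

(* A program halts when its program counter leaves the program; the
   configuration is then a fixed point of [step]. *)
Definition step (P : program) (c : config) : config :=
  let: (pc, reg) := c in
  match onth P pc with
  | None => c
  | Some (Incr i) => (pc.+1, set_reg reg i (reg i).+1)
  | Some (DecJump i j) =>
      if reg i == 0 then (j, reg) else (pc.+1, set_reg reg i (reg i).-1)
  end.

(* Input and output are in register 0. *)
Definition computes (P : program) (x y : nat) : Prop :=
  exists k : nat,
    let c := iter k (step P) (0, set_reg (fun _ => 0) 0 x) in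
    size P <= c.1 /\ c.2 0 = y.

(* The problem [Q] is decidable on the instances satisfying [dom]: some machine
   halts on the code of each such instance, with the right answer (1 for yes,
   0 for no). Nothing is required of the machine on other inputs. *)
Definition decidable_on (X : Type) (code : X -> nat) (dom : X -> bool)
    (Q : X -> Prop) : Prop :=
  exists P : program, forall x : X, dom x ->
    exists2 b : bool, computes P (code x) b & (b <-> Q x).

(* Main.v *)
(* Diagonalisation against a hypothetical decider, through a TBox that describes
   a run of a register machine Q on input x.

   Finite branching makes transitivity count. If t is transitive and all t(d)
   have the same finite size, then e in t(d) implies t(e) = t(d), since
   t(e) is included in t(d). The common size is [CBox] counted by [SUniv]; it is
   global because [SUniv] is transitive and every element sees exactly one
   [CRoot], so that the root sees a finite clique. A configuration of Q is a
   value of t_0 (even times) or of t_1 (odd times), and the content of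
   register i is the number of its elements in [CReg i]. A time element d sees its
   own configuration through one of t_0, t_1 and the next one through the other,
   and can therefore compare register contents; the next time element is found
   in the next configuration, which it sees identically. Numerical
   constraints only mention non-transitive copies of t_0 and t_1: t_b is role b.+1 and its copy
   is role b.+3, while role 0 is transitive and equal to [SUniv].

   The TBox says that Q started on x never reaches the program counter size Q.
   On input x = code of the axioms for Q, the machine Q prepends the axiom
   stating that the input is x, runs the decider on the result, and stops at
   size Q if the answer is yes, beyond it if the answer is no. *)
From mathcomp Require Import all_boot finmap.
From mathcomp Require Import boolp classical_sets functions cardinality.
Require Import Defs.

Set Implicit Arguments.
Unset Strict Implicit.
Unset Printing Implicit Defensive.

Definition reach (P : program) (c c' : config) : Prop :=
  exists k, iter k (step P) c = c'.

Lemma reach_trans P c1 c2 c3 : reach P c1 c2 -> reach P c2 c3 -> reach P c1 c3.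
Proof. by move=> [k <-] [l <-]; exists (l + k); rewrite iterD. Qed.

Lemma reach_step P c : reach P c (step P c).
Proof. by exists 1. Qed.

(* [Loop i c] is [while r_i > 0 do (r_i := r_i - 1; c)]. *)
Inductive cmd : Type :=
  | Skip
  | Inc of nat
  | Seq of cmd & cmd
  | Loop of nat & cmd.

Fixpoint cmd_regs (c : cmd) : seq nat :=
  match c with
  | Skip => [::]
  | Inc i => [:: i]
  | Seq c d => cmd_regs c ++ cmd_regs d
  | Loop i c => i :: cmd_regs c
  end.

(* The body of a loop does not touch the loop register, so that the number of
   iterations is the initial value of that register. *)
Fixpoint wf_cmd (c : cmd) : bool :=
  match c with
  | Skip | Inc _ => true
  | Seq c d => wf_cmd c && wf_cmd d
  | Loop i c => (i \notin cmd_regs c) && wf_cmd c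
  end.

Fixpoint run (c : cmd) (s : seq nat) : seq nat :=
  match c with
  | Skip => s
  | Inc i => set_nth 0 s i (nth 0 s i).+1
  | Seq c d => run d (run c s)
  | Loop i c =>
      iter (nth 0 s i) (fun s => run c (set_nth 0 s i (nth 0 s i).-1)) s
  end.

(* [o] is the address of the first instruction; register [z] is assumed to stay
   0, which makes [DecJump z o] an unconditional jump. *)
Fixpoint compile (z o : nat) (c : cmd) : program :=
  match c with
  | Skip => [::]
  | Inc i => [:: Incr i]
  | Seq c d => compile z o c ++ compile z (o + size (compile z o c)) d
  | Loop i c =>
      DecJump i (o + (size (compile z o.+1 c)).+2)
        :: rcons (compile z o.+1 c) (DecJump z o)
  end.

Lemma nth_run c s i : i \notin cmd_regs c -> nth 0 (run c s) i = nth 0 s i.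
Proof.
elim: c s => //= [j|c IHc d IHd|j c IHc] s; rewrite ?inE ?mem_cat ?negb_or.
- by move=> /negPf ji; rewrite nth_set_nth /= ji.
- by case/andP=> ic id; rewrite IHd // IHc.
- case/andP=> /negPf ij ic; elim: (nth 0 s j) => //= n IHn.
  by rewrite IHc // nth_set_nth /= ij.
Qed.

Lemma set_reg_nth s i v : set_reg (nth 0 s) i v = nth 0 (set_nth 0 s i v).
Proof. by apply/funext => j; rewrite nth_set_nth. Qed.

Lemma onth_size_cat (p q : program) a : onth (p ++ a :: q) (size p) = Some a.
Proof. by rewrite onth_cat ltnn subnn. Qed.

Lemma compile_reach z c p q s :
    wf_cmd c -> z \notin cmd_regs c -> nth 0 s z = 0 ->
  reach (p ++ compile z (size p) c ++ q) (size p, nth 0 s)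
    (size p + size (compile z (size p) c), nth 0 (run c s)).
Proof.
elim: c p q s => /= [|i|c IHc d IHd|i c IHc] p q s.
- by rewrite addn0; exists 0.
- rewrite inE => _ _ _; exists 1; rewrite /= onth_size_cat.
  by rewrite set_reg_nth addn1.
- move=> /andP[wfc wfd]; rewrite mem_cat negb_or => /andP[zc zd] s0.
  rewrite -catA; apply: reach_trans (IHc _ _ _ wfc zc s0) _.
  rewrite size_cat addnA catA -size_cat; apply: IHd => //.
  by rewrite nth_run.
- move=> /andP[ic wfc]; rewrite inE negb_or => /andP[zi zc].
  set b := compile _ _ _; set Q := p ++ _.
  have oneiter t n : nth 0 t z = 0 -> nth 0 t i = n.+1 ->
      reach Q (size p, nth 0 t) (size p, nth 0 (run c (set_nth 0 t i n))).
    move=> tz ti; apply: reach_trans (reach_step _ _) _.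
    rewrite /= onth_size_cat ti /= set_reg_nth.
    have {IHc} := IHc (rcons p (DecJump i (size p + (size b).+2)))
      (DecJump z (size p) :: q) (set_nth 0 t i n) wfc zc.
    rewrite nth_set_nth /= (negPf zi) size_rcons -/b !cat_rcons => /(_ tz) IHc.
    have EQ : Q = (p ++ DecJump i (size p + (size b).+2) :: b)
        ++ DecJump z (size p) :: q by rewrite /Q /= cat_rcons -catA.
    move: IHc; rewrite [p ++ _ :: b ++ _](catA p (_ :: b)) -EQ => IHc.
    apply: reach_trans IHc _.
    have -> : (size p).+1 + size b =
      size (p ++ DecJump i (size p + (size b).+2) :: b).
      by rewrite size_cat addSnnS.
    exists 1; rewrite /= EQ onth_size_cat nth_run // nth_set_nth /= (negPf zi).
    by rewrite tz.
  have [n sin] : exists n, nth 0 s i = n by exists (nth 0 s i).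
  rewrite sin; elim: n s sin => [|n IHn] s si sz.
    by exists 1; rewrite /= onth_size_cat si size_rcons.
  rewrite iterSr si; apply: reach_trans (oneiter _ _ sz si) (IHn _ _ _).
    by rewrite nth_run // nth_set_nth /= eqxx.
  by rewrite nth_run // nth_set_nth /= (negPf zi).
Qed.

(* Jumps leaving [P] are redirected to the end of its relocated copy. *)
Definition relocate (o : nat) (P : program) : program :=
  [seq match a with
       | Incr i => Incr i
       | DecJump i j => DecJump i (o + minn j (size P))
       end | a <- P].

Lemma relocate_reach p P q k c :
  let at_ (c : config) := (size p + minn c.1 (size P), c.2) in
  reach (p ++ relocate (size p) P ++ q) (at_ c) (at_ (iter k (step P) c)).
Proof.
move=> at_; elim: k => [|k IHk]; first by exists 0.
apply: reach_trans IHk _; rewrite iterS.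
case: (iter k _ c) => [pc r].
have [/onth_default Ppc | ltpc] := leqP (size P) pc.
  by exists 0; rewrite /= Ppc.
exists 1; rewrite /= /at_ /= (minn_idPl (ltnW ltpc)).
rewrite onth_cat ltnNge leq_addr addKn /= onth_cat size_map ltpc onth_map.
case: onth (onthTE P pc) => [[i|i j] _|]; rewrite ?ltpc //=.
  by rewrite (minn_idPl ltpc) addnS.
by case: ifP => //= _; rewrite (minn_idPl ltpc) addnS.
Qed.

Definition add_const (i k : nat) : cmd := iter k (Seq (Inc i)) Skip.

(* Register 1 is kept at 0. [cons_cmd] replaces register 5 by
   [CodeSeq.code (r4 :: s)], where [CodeSeq.code s] is its old value, and clears
   register 4, with register 6 as scratch space. *)
Definition double_cmd : cmd :=
  Seq (Loop 5 (Seq (Inc 6) (Inc 6))) (Loop 6 (Inc 5)).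

Definition cons_cmd : cmd := Seq double_cmd (Seq (Inc 5) (Loop 4 double_cmd)).

Definition wrap_cmd (pre suf : seq nat) : cmd :=
  Seq (add_const 5 (CodeSeq.code suf))
 (Seq cons_cmd
 (Seq (foldr (fun n c => Seq c (Seq (add_const 4 n) cons_cmd)) Skip pre)
      (Loop 5 (Inc 4)))).

Lemma run_add4 x y z c m t k :
  run (add_const 4 k) [:: x; 0; y; z; c; m; t] = [:: x; 0; y; z; c + k; m; t].
Proof. by elim: k c => [|k IHk] c; rewrite ?addn0 //= IHk addSnnS. Qed.

Lemma run_add5 x y z c m t k :
  run (add_const 5 k) [:: x; 0; y; z; c; m; t] = [:: x; 0; y; z; c; m + k; t].
Proof. by elim: k m => [|k IHk] m; rewrite ?addn0 //= IHk addSnnS. Qed.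

Lemma run_double x y z c m :
  run double_cmd [:: x; 0; y; z; c; m; 0] = [:: x; 0; y; z; c; m.*2; 0].
Proof.
rewrite [LHS]/=.
have -> t : iter m (fun s => run (Seq (Inc 6) (Inc 6))
    (set_nth 0 s 5 (nth 0 s 5).-1)) [:: x; 0; y; z; c; m; t] =
    [:: x; 0; y; z; c; 0; t + m.*2].
  elim: m t => [|m IHm] t; first by rewrite addn0.
  by rewrite iterSr IHm doubleS !addnS.
rewrite add0n /=.
have E n t : iter n (fun s => run (Inc 5)
    (set_nth 0 s 6 (nth 0 s 6).-1)) [:: x; 0; y; z; c; t; n] =
    [:: x; 0; y; z; c; t + n; 0].
  elim: n t => [|n IHn] t; first by rewrite addn0.
  by rewrite iterSr IHn addnS.
exact: E.
Qed.

Lemma run_seq c d s : run (Seq c d) s = run d (run c s).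
Proof. by []. Qed.

Lemma run_loop i c s :
  run (Loop i c) s =
  iter (nth 0 s i) (fun s => run c (set_nth 0 s i (nth 0 s i).-1)) s.
Proof. by []. Qed.

Lemma run_cons x y z c s :
  run cons_cmd [:: x; 0; y; z; c; CodeSeq.code s; 0] =
  [:: x; 0; y; z; 0; CodeSeq.code (c :: s); 0].
Proof.
rewrite /cons_cmd 2!run_seq run_double [run (Inc 5) _]/= run_loop [nth 0 _ 4]/=.
have -> : CodeSeq.code (c :: s) = 2 ^ c * (CodeSeq.code s).*2.+1 by [].
elim: c (CodeSeq.code s).*2.+1 => [|c IHc] m; first by rewrite mul1n.
rewrite iterSr [set_nth _ _ _ _]/= run_double IHc.
by rewrite -mul2n expnS mulnCA mulnA.
Qed.

Lemma run_wrap x y z c pre suf :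
  run (wrap_cmd pre suf) [:: x; 0; y; z; c; 0; 0] =
  [:: x; 0; y; z; CodeSeq.code (pre ++ c :: suf); 0; 0].
Proof.
rewrite /wrap_cmd 3!run_seq run_add5 add0n run_cons.
set b := foldr _ _ pre.
have -> : run b [:: x; 0; y; z; 0; CodeSeq.code (c :: suf); 0] =
    [:: x; 0; y; z; 0; CodeSeq.code (pre ++ c :: suf); 0].
  rewrite /b; elim: pre {b} => // n pre IHpre.
  rewrite [foldr _ _ _]/= 2!run_seq IHpre run_add4 add0n.
  exact: run_cons.
rewrite run_loop [nth 0 _ 5]/=; move: (CodeSeq.code (pre ++ _)) => m.
suff E n : iter m (fun s => run (Inc 4) (set_nth 0 s 5 (nth 0 s 5).-1))
  [:: x; 0; y; z; n; m; 0] = [:: x; 0; y; z; n + m; 0; 0] by exact: E.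
elim: m n => [|m IHm] n; first by rewrite addn0.
by rewrite iterSr IHm addnS.
Qed.

Local Open Scope classical_set_scope.

Lemma sub_card_eq T (A B : set T) :
  finite_set A -> B `<=` A -> card B = card A -> B = A.
Proof.
move=> finA BA cBA.
have finB : finite_set B := sub_finite_set BA finA.
apply: (@fset_set_inj {classic T}) => //; apply/eqP.
rewrite eqEfcard (eq_leq (esym cBA)) andbT; apply/fsubsetP => x.
by rewrite !in_fset_set //; rewrite !inE => /BA.
Qed.

Lemma card_eq1 T (A : set T) : finite_set A -> card A = 1 -> exists a, A = [set a].
Proof.
move=> finA /eqP/cardfs1P[a Aa]; exists a.
apply: (@fset_set_inj {classic T}) => //.
by rewrite Aa fset_set1.
Qed.

Lemma card_block a b (j v : nat) : j <= a -> v <= b.+1 ->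
  card [set e : 'I_a.+1 * 'I_b.+1 | e.1 = j :> nat /\ e.2 < v] = v.
Proof.
move=> ja vb; apply: card_fset_set.
rewrite (_ : [set _ | _] =
  (fun m : nat => (inord j : 'I_a.+1, inord m : 'I_b.+1)) @` `I_v).
  apply: inj_card_eq => m m'; rewrite !inE /= => mv m'v [/(congr1 val)] /=.
  by rewrite !inordK // (leq_trans _ vb).
apply/seteqP; split=> [[j' m] /= [<- mv]|_ [m /= mv <-]] /=.
  by exists m => //; rewrite !inord_val.
by rewrite !inordK // (leq_trans _ vb).
Qed.

Lemma model_cat I T1 T2 : model I (T1 ++ T2) <-> model I T1 /\ model I T2.
Proof.
rewrite /model; elim: T1 => [|a T1 IH] /=; first by split=> [|[]].
by rewrite IH; split=> [[? []]|[[]]].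
Qed.

Lemma model_map I (f : nat -> axiom) s :
  model I (map f s) <-> forall i, i \in s -> sat_axiom I (f i).
Proof.
rewrite /model; elim: s => [|i s IH] /=; first by split.
rewrite IH; split=> [[fi fs] j|fs]; last first.
  by split=> [|j js]; apply: fs; rewrite inE ?eqxx ?js ?orbT.
by rewrite inE => /predU1P[->|/fs].
Qed.

Lemma model_flatten_map I (f : nat -> tbox) s :
  model I (flatten (map f s)) <-> forall i, i \in s -> model I (f i).
Proof.
elim: s => [|i s IH] /=; first by split.
rewrite model_cat IH; split=> [[fi fs] j|fs]; last first.
  by split=> [|j js]; apply: fs; rewrite inE ?eqxx ?js ?orbT.
by rewrite inE => /predU1P[->|/fs].
Qed.

Definition CTop := CSucc (SubC SEmpty SEmpty).
Definition CRoot := CName 0.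
Definition CBox := CName 1.
Definition CTime (b : bool) := CName b.+2.
Definition CReg (i : nat) := CName i.*2.+4.
Definition CPc (p : nat) := CName p.*2.+1.+4.

Definition size_expr (s : sterm) : pexpr := PAdd (PConst 0) 1 s.

Definition reg_expr (k b : bool) (i : nat) : pexpr :=
  PAdd (PConst k) 1 (SCap (SRole b.+3) (SConcept (CReg i))).

(* Elements of [c], of parity [b], have a next element; it has program counter
   [p], and the value of register [i] plus [g i] there is the value here plus
   [f i]. *)
Definition move_axioms (n : nat) (c : concept) (b : bool) (p : nat)
    (f g : nat -> bool) : tbox :=
  let next := SCap (SRole (~~ b).+1) (SConcept (CTime (~~ b))) in
  [:: CI c (CNot (CSucc (SubC next SEmpty)));
      CI c (CSucc (SubC next (SConcept (CPc p))))] ++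
  [seq CI c (CSucc (NumEq (reg_expr (f i) b i) (reg_expr (g i) (~~ b) i)))
     | i <- iota 0 n].

Definition instr_axioms (n : nat) (b : bool) (p : nat) (a : instr) : tbox :=
  let c := CAnd (CTime b) (CPc p) in
  match a with
  | Incr i => move_axioms n c b p.+1 (pred1 i) pred0
  | DecJump i j =>
      let z := CSucc (NumEq (reg_expr false b i) (PConst 0)) in
      move_axioms n (CAnd c z) b j pred0 pred0 ++
      move_axioms n (CAnd c (CNot z)) b p.+1 pred0 (pred1 i)
  end.

Definition common_axioms (bad : nat) : tbox :=
  [:: CI CTop (CSucc (EqC SUniv (SRole 0)));
      CI CTop (CSucc (EqC (SRole 1) (SRole 3)));
      CI CTop (CSucc (EqC (SRole 2) (SRole 4)));
      CI CTop (CSucc (NumEq (size_expr (SConcept CRoot)) (PConst 1)));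
      CI CTop (CSucc (NumEq (size_expr (SRole 3)) (size_expr (SConcept CBox))));
      CI CTop (CSucc (NumEq (size_expr (SRole 4)) (size_expr (SConcept CBox))));
      CI CRoot (CAnd (CTime false) (CPc 0));
      CI (CPc bad) (CNot CTop)].

Definition program_axioms (n : nat) (Q : program) : tbox :=
  [:: Trans 0; Trans 1; Trans 2] ++ common_axioms (size Q) ++
  [seq CI CRoot (CSucc (NumEq (reg_expr false false i) (PConst 0)))
     | i <- iota 1 n] ++
  flatten [seq oapp (instr_axioms n false p) [::] (onth Q p) ++
               oapp (instr_axioms n true p) [::] (onth Q p)
            | p <- iota 0 (size Q)].

(* Its value is [x], since there is exactly one root. *)
Definition numeral (x : nat) : pexpr :=
  iter x (fun l => PAdd l 1 (SConcept CRoot)) (PConst 0).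

Definition input_axiom (x : nat) : axiom :=
  CI CRoot (CSucc (NumEq (numeral x) (reg_expr false false 0))).

Lemma pval_numeral (I : interp) (d : dom I) x :
  card (cname 0 `&` ars d) = 1 -> pval d (numeral x) = x.
Proof. by move=> root1; elim: x => //= x ->; rewrite root1 mul1n addn1. Qed.

Definition regs_lt (n : nat) (Q : program) : bool :=
  all (fun a => match a with Incr i | DecJump i _ => i < n end) Q.

Lemma all_onth T (a : pred T) s i x : all a s -> onth s i = Some x -> a x.
Proof. by elim: s i => [|y s IHs] [|i] //= /andP[ay /IHs]; [move=> _ [<-]|exact]. Qed.

Lemma sat_move (I : interp) n c b p f g :
    model I (move_axioms n c b p f g) ->
  forall d : dom I, @cext I c d ->
  [/\ exists2 e, role (~~ b).+1 d e & (@cext I (CTime (~~ b)) `&` ars d) e,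
      role (~~ b).+1 d `&` (@cext I (CTime (~~ b)) `&` ars d) `<=`
        @cext I (CPc p) &
      forall i, i < n ->
        card (role b.+3 d `&` (@cext I (CReg i) `&` ars d)) + f i =
        card (role (~~ b).+3 d `&` (@cext I (CReg i) `&` ars d)) + g i].
Proof.
case/model_cat=> /= [[ex [all_p _]] /model_map counts] d cd; split.
- apply: contra_notP (ex d cd) => noe e [re Te]; apply: noe; by exists e.
- by move=> e /(all_p d cd) [].
- move=> i ltin; have := counts i; rewrite mem_iota /= => /(_ ltin d cd) /=.
  by rewrite !mul1n ![_ + card _]addnC.
Qed.

Definition init (x : nat) : config := (0, set_reg (fun _ => 0) 0 x).

Definition at_config n (I : interp) (o e : dom I) (b : bool) (c : config) :=
  [/\ ars o e, @cext I (CTime b) e, @cext I (CPc c.1) e &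
      forall i, i < n ->
        card (role b.+3 e `&` (@cext I (CReg i) `&` ars e)) = c.2 i].

Lemma consistent_run n Q x : 0 < n -> regs_lt n Q ->
    consistent (input_axiom x :: program_axioms n Q) ->
  forall k, (iter k (step Q) (init x)).1 <> size Q.
Proof.
move=> n_gt0 Qn [I [fb [inp axioms]]].
have /model_cat[[tr0 [tr1 [tr2 _]]]] : model I (program_axioms n Q) := axioms.
case/model_cat=> common /model_cat[/model_map init0 /model_flatten_map instrs].
case: common => univ [eq13 [eq24 [root [size3 [size4 [start [bad _]]]]]]].
have top (d : dom I) : @cext I CTop d by [].
have {}univ (d : dom I) : ars d = role 0 d := univ d (top d).
have eqtr (b : bool) (d : dom I) : role b.+1 d = role b.+3 d.
  by case: b; [exact: (eq24 d (top d))|exact: (eq13 d (top d))].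
have {}root (d : dom I) : card (cname 0 `&` ars d) = 1.
  by have := root d (top d); rewrite /= mul1n.
have {size3 size4} sizes (b : bool) (d : dom I) :
    card (role b.+3 d) = card (cname 1 `&` ars d).
  case: b; [have := size4 d (top d) | have := size3 d (top d)];
  by rewrite /= !mul1n !add0n => ->.
have trans (b : bool) (d e f : dom I) : role b.+1 d e -> role b.+1 e f -> role b.+1 d f.
  by case: b; [apply: tr2|apply: tr1].
have arsT (d e : dom I) : ars d e -> ars e `<=` ars d.
  by rewrite !univ => de f; apply: tr0.
have rootP (d : dom I) : exists2 o, cname 0 o /\ ars d o &
    forall o', cname 0 o' -> ars d o' -> o' = o.
  have [|o Ro] := card_eq1 _ (root d); first by apply: finite_setIr; exact: fb.
  exists o => [|o' ro' do']; first by have : [set o] o by []; rewrite -Ro.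
  by have : [set o] o' by rewrite -Ro.
have [d0] := dom_inhabited I.
have [o [ro d0o] o_uniq] := rootP d0.
have clique (e : dom I) : ars o e -> ars e = ars o.
  move=> oe; apply/seteqP; split; first exact: arsT.
  have [o' [ro' eo'] _] := rootP e.
  apply: (arsT); rewrite -(o_uniq o') //.
  by apply: (arsT _ _ d0o); apply: (arsT _ _ oe).
have oo : ars o o.
  have [o' [ro' oo'] _] := rootP o.
  by rewrite -{2}(o_uniq o') //; apply: (arsT _ _ d0o).
suff main k : exists e b, at_config n o e b (iter k (step Q) (init x)).
  move=> k pck; have [e [b [_ _ + _]]] := main k.
  by rewrite pck => /bad; apply.
elim: k => [|k [e [b]]].
  exists o, false; have [Eo Po] := start o ro; split=> // i ltin /=.
  rewrite /set_reg; have [->|i_neq0] := eqVneq i 0.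
    by have /= := inp o ro; rewrite pval_numeral // mul1n => ->.
  have := init0 i; rewrite mem_iota add1n ltnS lt0n i_neq0 (ltnW ltin) => /(_ isT).
  by move=> /(_ o ro) /=; rewrite mul1n.
rewrite iterS; case: (iter _ _ _) => pc r {k} [/= oe Te Pe regs].
have [/onth_default Qpc|ltpc] := leqP (size Q) pc.
  by exists e, b; rewrite /= Qpc.
have next c p f g : model I (move_axioms n c b p f g) ->
    @cext I c e -> forall s, (forall i, i < n -> s i + g i = r i + f i) ->
    exists e' b'', at_config n o e' b'' (p, s).
  move=> mv ce s sr; have [[e' re' [Te' ee']] pcs cards] := sat_move mv ce.
  have oe' : ars o e' by rewrite -(clique e).
  exists e', (~~ b); split=> //; first exact: pcs.
  move=> i ltin /=; apply: (@addIn (g i)); rewrite sr // -regs // cards //.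
  congr (card (_ `&` (_ `&` _)) + _); last by rewrite !clique.
  apply: sub_card_eq; last by rewrite !sizes !clique.
    by apply: sub_finite_set (fb e) => f' rf'; exists (~~ b).+3.
  by rewrite -!eqtr => f'; apply: trans re'.
have := instrs pc; rewrite mem_iota /= => /(_ ltpc) /model_cat [].
have := onthTE Q pc; rewrite ltpc.
case Qpc: (onth Q pc) => [a|] // _; have := all_onth Qn Qpc.
have cE : @cext I (CAnd (CTime b) (CPc pc)) e by [].
move=> ai m0 m1.
have {m0 m1} : model I (instr_axioms n b pc a) by case: (b).
case: a ai {Qpc} => [i|i j] ltin; rewrite /instr_axioms.
  move=> /next; apply=> // i' _; rewrite /set_reg addn0 /=.
  by case: eqP => [->|_]; rewrite ?addn0 // addn1.
move=> /model_cat[]; case: eqP => [r0 /next + _|/eqP r0 _ /next].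
  by apply=> //; split=> //=; rewrite mul1n regs.
apply=> // [|i' _].
  by split=> //=; rewrite mul1n regs // => /eqP; apply/negP.
rewrite /set_reg addn0 /=; case: eqP => [->|_]; rewrite ?addn0 // addn1.
by rewrite prednK // lt0n.
Qed.

(* The model for a run that halts beyond size Q after k steps: the elements (j, m)
   form configuration j, and (j, 0) is its time element. *)
Section RunModel.

Variables (Q : program) (x k : nat).

Let conf (j : nat) : config := iter j (step Q) (init x).

Let D : finType := ('I_k.+1 * 'I_(x + k).+1)%type.

(* The configuration that the elements of configuration [j] see through t_b; the
   minimum only matters for the missing configuration k.+1. *)
Definition block (b : bool) (j : nat) : nat :=
  if odd j == b then j else minn j.+1 k.

Lemma block_id b j : block b (block b j) = block b j.
Proof.
rewrite /block; have [ojb|ojb] := eqVneq (odd j) b; first by rewrite ojb eqxx.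
have [ltjk|lekj] := ltnP j k; last first.
  rewrite (minn_idPr (leqW lekj)); case: eqP => // _.
  by rewrite (minn_idPr (leqnSn _)).
by rewrite (minn_idPl ltjk) /= ; case: (odd j) b ojb => [] [].
Qed.

Lemma block_le b j : j <= k -> block b j <= k.
Proof. by rewrite /block; case: ifP => // _ _; rewrite geq_minr. Qed.

Definition run_cname (A : nat) (d : D) : Prop :=
  match A with
  | 0 => d.1 = 0 :> nat /\ d.2 = 0 :> nat
  | 1 => d.1 = 0 :> nat
  | 2 => d.2 = 0 :> nat /\ odd d.1 = false
  | 3 => d.2 = 0 :> nat /\ odd d.1 = true
  | A'.+4 => if odd A' then d.2 = 0 :> nat /\ (conf d.1).1 = A'./2
             else d.2 < (conf d.1).2 A'./2
  end.

Definition run_role (r : nat) (d e : D) : Prop :=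
  match r with
  | 0 => True
  | 1 | 3 => e.1 = block false d.1 :> nat
  | 2 | 4 => e.1 = block true d.1 :> nat
  | _ => False
  end.

Definition run_interp : interp :=
  @Interp D (inhabits (ord0, ord0)) run_cname run_role.

Let I := run_interp.

Lemma run_roleS (b : bool) (d e : dom I) :
  (role b.+1 d e <-> e.1 = block b d.1 :> nat) /\
  (role b.+3 d e <-> e.1 = block b d.1 :> nat).
Proof. by case: b. Qed.

Lemma run_ars (d : dom I) : ars d = setT.
Proof. by apply/seteqP; split=> // e _; exists 0. Qed.

Lemma run_finite : finitely_branching I.
Proof. by move=> d; rewrite run_ars; exact: (@finite_finset D). Qed.

Lemma run_time b (d : dom I) :
  @cext I (CTime b) d <-> d.2 = 0 :> nat /\ odd d.1 = b.
Proof. by case: b. Qed.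

Lemma run_pc p (d : dom I) :
  @cext I (CPc p) d <-> d.2 = 0 :> nat /\ (conf d.1).1 = p.
Proof. by rewrite /= odd_double uphalf_double. Qed.

Lemma run_reg i (d : dom I) : @cext I (CReg i) d <-> d.2 < (conf d.1).2 i.
Proof. by rewrite /= odd_double doubleK. Qed.

Lemma conf_le j i : (conf j).2 i <= x + j.
Proof.
rewrite /conf; elim: j => [|j].
  by rewrite addn0 /= /set_reg; case: ifP.
rewrite iterS; case: (iter j _ _) => pc r /= rj.
have rj1 : r i <= x + j.+1 by rewrite addnS ltnW.
case: onth => [[i'|i' j']|] //=; last case: ifP => //= _.
  by rewrite /set_reg; case: eqP => // <-; rewrite addnS ltnS.
by rewrite /set_reg; case: eqP => // <-; rewrite (leq_trans (leq_pred _)).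
Qed.

Lemma card_run_reg (b : bool) i (d : dom I) :
  card (role b.+3 d `&` (@cext I (CReg i) `&` ars d)) =
  (conf (block b d.1)).2 i.
Proof.
rewrite run_ars setIT -[RHS](@card_block k (x + k) (block b d.1)); first last.
- apply: leq_trans (conf_le _ _) _.
  by rewrite ltnW // ltnS leq_add2l block_le // -ltnS.
- by rewrite block_le // -ltnS.
congr card; apply/seteqP; split=> e; rewrite /setI /mkset run_reg (run_roleS b d e).2;
  by case=> [-> ?].
Qed.

Lemma card_run_block (b : bool) (d : dom I) : card (role b.+3 d) = (x + k).+1.
Proof.
rewrite -[RHS](@card_block k (x + k) (block b d.1)) //.
  by congr card; apply/seteqP; split=> e; rewrite /mkset (run_roleS b d e).2 // => -[].
by rewrite block_le // -ltnS.
Qed.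

Lemma card_run_box (d : dom I) : card (cname 1 `&` ars d) = (x + k).+1.
Proof.
rewrite run_ars setIT -[RHS](@card_block k (x + k) 0) //.
by congr card; apply/seteqP; split=> e //= -[].
Qed.

Lemma card_run_root (d : dom I) : card (cname 0 `&` ars d) = 1.
Proof.
rewrite run_ars setIT -[RHS](@card_block k (x + k) 0) //.
by congr card; apply/seteqP; split=> e /= -[-> e2]; rewrite ?e2 //; case: (val _) e2.
Qed.

Lemma run_common bad : (forall j, j <= k -> (conf j).1 <> bad) ->
  model I (common_axioms bad).
Proof.
move=> nbad; rewrite /model /=.
repeat match goal with |- _ /\ _ => split end => //;
  move=> d; rewrite /= ?mul1n ?add0n => Hd //.
- exact: run_ars.
- by rewrite card_run_root.
- by rewrite (card_run_block false) card_run_box.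
- by rewrite (card_run_block true) card_run_box.
- by case: Hd => d1 d2; rewrite d1 d2.
- move: Hd; rewrite odd_double uphalf_double => -[_ dbad] _.
  by apply: nbad dbad; rewrite -ltnS.
Qed.

Lemma run_trans (b : bool) : sat_axiom I (Trans b.+1).
Proof.
by case: b => d e f /= de ef; rewrite [LHS]ef de block_id.
Qed.

Lemma run_move n (c : concept) (b : bool) p (f g : nat -> bool) :
    (forall d : dom I, @cext I c d ->
      [/\ @cext I (CTime b) d, d.1 < k, (conf d.1.+1).1 = p &
          forall i, (conf d.1).2 i + f i = (conf d.1.+1).2 i + g i]) ->
  model I (move_axioms n c b p f g).
Proof.
move=> step_c; apply/model_cat; split.
  have next d : @cext I c d -> d.2 = 0 :> nat /\ block (~~ b) d.1 = d.1.+1.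
    case/step_c => /run_time[d2 <-] ltdk _ _; split=> //.
    by rewrite /block; case: odd; rewrite (minn_idPl ltdk).
  split=> [d cd|]; last split=> // d cd.
  - have [_ ltdk _ _] := step_c _ cd; have [_ bl] := next _ cd.
    have [/run_time[_ od] _ _ _] := step_c _ cd.
    pose e : dom I := (inord d.1.+1, ord0).
    have e1 : e.1 = d.1.+1 :> nat by rewrite inordK.
    move=> /(_ e) []; split.
      by case: (b) bl => /= ->.
    rewrite /setI /mkset run_ars; split=> //.
    by apply/run_time; rewrite e1 /= od.
  - move=> e [re [/run_time[e2 _] _]]; split; last by rewrite run_ars.
    apply/run_pc; split=> //; have [_ bl] := next _ cd.
    have [_ _ <- _] := step_c _ cd.
    by rewrite -bl; case: (b) re => /= ->.
apply/model_map => i _ d cd.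
have [/run_time[d2 od] ltdk _ cs] := step_c _ cd.
rewrite /= !mul1n (card_run_reg b) (card_run_reg (~~ b)) addnC [RHS]addnC.
rewrite /block od eqxx (_ : b == ~~ b = false) ?(minn_idPl ltdk) //.
by case: (b).
Qed.

Lemma run_instr n (b : bool) p a :
    size Q <= (conf k).1 -> onth Q p = Some a ->
  model I (instr_axioms n b p a).
Proof.
move=> Qk Qp.
have pq : p < size Q by rewrite -onthTE Qp.
have step_c (d : dom I) : @cext I (CAnd (CTime b) (CPc p)) d ->
    [/\ @cext I (CTime b) d, d.1 < k, (conf d.1).1 = p &
        conf d.1.+1 = step Q (p, (conf d.1).2)].
  case=> Td /run_pc[d2 cp]; split=> //.
    rewrite ltn_neqAle -ltnS ltn_ord andbT; apply/eqP => dk.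
    by move: Qk; rewrite -dk cp leqNgt pq.
  by rewrite -cp -surjective_pairing.
have zeroP (d : dom I) i : @cext I (CAnd (CTime b) (CPc p)) d ->
    @cext I (CSucc (NumEq (reg_expr false b i) (PConst 0))) d <->
    (conf d.1).2 i = 0.
  case=> /run_time[_ od] _; rewrite /= mul1n add0n (card_run_reg b).
  by rewrite /block od eqxx.
case: a Qp => [i|i j] Qp.
  apply: run_move => d /step_c[Td ltdk cp cs]; split=> //; rewrite cs /= Qp //.
  move=> i'; rewrite /= /set_reg /pred1 /= addn0.
  by case: eqP => [->|_]; rewrite ?addn0 ?addn1.
apply/model_cat; split; apply: run_move => d [cd zd];
    have [Td ltdk cp cs] := step_c _ cd; split=> //; rewrite cs /= Qp.
- by move/(zeroP _ _ cd): zd => ->; rewrite eqxx.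
- by move/(zeroP _ _ cd): zd => ->; rewrite eqxx.
- by case: eqP => // r0; case: zd; apply/(zeroP _ _ cd).
- case: eqP => [r0|/eqP r0 i']; first by case: zd; apply/(zeroP _ _ cd).
  rewrite /= /set_reg addn0; case: eqP => [->|_]; rewrite ?addn0 // addn1.
  by rewrite prednK // lt0n.
Qed.

Lemma run_init i (d : dom I) : @cext I CRoot d ->
  card (role 3 d `&` (@cext I (CReg i) `&` ars d)) = (init x).2 i.
Proof. by case=> d1 _; rewrite (card_run_reg false) d1. Qed.

Lemma run_model n : size Q < (conf k).1 ->
  model I (input_axiom x :: program_axioms n Q).
Proof.
move=> halt; rewrite -cat1s; apply/model_cat; split.
  split=> // d Rd /=; rewrite mul1n add0n run_init // pval_numeral //.
  exact: card_run_root.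
apply/model_cat; split; first split=> //.
  by split; [exact: (@run_trans false)|split=> //; exact: (@run_trans true)].
apply/model_cat; split.
  apply: run_common => j lejk; move: halt.
  rewrite /conf -(subnK lejk) iterD ltnNge => /negP halt bad; case: halt.
  move: bad.
  case: (iter j _ _) => pc r /= ->.
  by elim: (k - j) => //= l IHl; rewrite iter_fix //= onth_default.
apply/model_cat; split.
  apply/model_map => i; rewrite mem_iota => /andP[i_gt0 _] d Rd /=.
  by rewrite mul1n add0n run_init //= /set_reg; case: eqP i_gt0 => // ->.
apply/model_flatten_map => p _; case Qp: (onth Q p) => [a|] //=.
by apply/model_cat; split; apply: run_instr Qp; apply: ltnW.
Qed.

End RunModel.

Lemma halt_consistent n Q x k :
    size Q < (iter k (step Q) (init x)).1 ->
  consistent (input_axiom x :: program_axioms n Q).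
Proof.
move=> halt; exists (run_interp Q x k); split; first exact: run_finite.
exact: run_model.
Qed.

Definition restricted_axiom (a : axiom) : bool :=
  match a with
  | Trans r => r <= 2
  | CI _ _ => all (fun c => all (ltn 2) (constraint_roles c) &&
                            all (fun n => n <= 1) (constraint_consts c))
                  (axiom_nums a)
  end.

Lemma restricted_all T : all restricted_axiom T -> restricted T.
Proof.
move=> okT.
have transT : all (fun r => r <= 2) (transitive_roles T).
  by elim: T okT => //= -[C D|r] T IHT /= /andP[okr /IHT] //= ->; rewrite okr.
have numsT : all (fun c => all (ltn 2) (constraint_roles c) &&
                           all (fun n => n <= 1) (constraint_consts c))
                 (tbox_nums T).
  elim: T okT {transT} => //= a T IHT /andP[oka /IHT okT].
  by rewrite /tbox_nums /= all_cat okT andbT; case: a oka.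
rewrite /restricted /only_01_constants /no_transitive_roles_in_nums.
apply/andP; split; apply: sub_all numsT => c /andP[rc cc] //.
apply: sub_all rc => r /= r_gt2; apply: contraL r_gt2 => /(allP transT).
by rewrite -leqNgt.
Qed.

Lemma restricted_input x : restricted_axiom (input_axiom x).
Proof.
have -> : restricted_axiom (input_axiom x) =
   all (ltn 2) (pexpr_roles (numeral x) ++ [:: 3]) &&
   all (fun n => n <= 1) (pexpr_consts (numeral x) ++ [:: 1; 0]) &&
   all (fun c => all (ltn 2) (constraint_roles c) &&
                 all (fun n => n <= 1) (constraint_consts c))
       (pexpr_nums (numeral x) ++ [::]) by [].
rewrite !all_cat !andbT.
by elim: x => // x /andP[/andP[r c] m]; rewrite /= !cats0 r c m.
Qed.

Lemma restricted_move n b p (f g : nat -> bool) c :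
  all (fun c => all (ltn 2) (constraint_roles c) &&
                all (fun n => n <= 1) (constraint_consts c)) (concept_nums c) ->
  all restricted_axiom (move_axioms n c b p f g).
Proof.
move=> okc; rewrite /= !all_cat okc /= all_map; apply/allP => i _ /=.
by rewrite all_cat okc /= !andbT; case: (f i) (g i) => [] [].
Qed.

Lemma restricted_program n Q : all restricted_axiom (program_axioms n Q).
Proof.
rewrite /program_axioms 3!all_cat; apply/and4P; split=> //.
  by rewrite all_map; apply/allP.
elim: (iota 0 _) => //= p l IHl.
have ok b : all restricted_axiom (oapp (instr_axioms n b p) [::] (onth Q p)).
  case: (onth Q p) => [[i|i j]|] //; rewrite /oapp /instr_axioms.
    exact: restricted_move.
  by rewrite all_cat; apply/andP; split; apply: restricted_move.
by rewrite !all_cat !ok.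
Qed.

Lemma regs_lt_bound Q : exists2 n, 0 < n & regs_lt n Q.
Proof.
elim: Q => [|a Q [n n_gt0 Qn]]; first by exists 1.
pose i := match a with Incr i | DecJump i _ => i end.
exists (maxn n i.+1); first by rewrite leq_max n_gt0.
apply/andP; split.
  have : i < maxn n i.+1 by rewrite leq_max leqnn orbT.
  by rewrite /i; case: (a).
by apply: sub_all Qn => -[j|j l] ltjn; rewrite leq_max ltjn.
Qed.

(* Register 0 holds [x = CodeSeq.code s]; copies go to register 2, to be extended
   by [cons_cmd], and to register 3, to count the iterations that build the code
   of [numeral x]. *)
Definition input_cmd (base one root reg0 : nat) : cmd :=
  Seq (Loop 0 (Seq (Inc 2) (Inc 3)))
 (Seq (add_const 4 base)
 (Seq (Loop 3 (wrap_cmd [:: 1] [:: 1; one]))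
 (Seq (wrap_cmd [:: 2] [:: reg0])
 (Seq (wrap_cmd [:: 3] [::])
 (Seq (wrap_cmd [:: 0; root] [::])
 (Seq (Loop 2 (Inc 5))
 (Seq cons_cmd
      (Loop 5 (Inc 0))))))))).

Lemma run_input base one root reg0 s : let x := CodeSeq.code s in
  let l := iter x (fun l => CodeSeq.code [:: 1; l; 1; one]) base in
  run (input_cmd base one root reg0) [:: x; 0; 0; 0; 0; 0; 0] =
  [:: CodeSeq.code (CodeSeq.code [:: 0; root; CodeSeq.code
      [:: 3; CodeSeq.code [:: 2; l; reg0]]] :: s); 0; 0; 0; 0; 0; 0].
Proof.
move=> x l; rewrite /input_cmd 8!run_seq.
have -> : run (Loop 0 (Seq (Inc 2) (Inc 3))) [:: x; 0; 0; 0; 0; 0; 0] =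
    [:: 0; 0; x; x; 0; 0; 0].
  rewrite run_loop /= -[X in _ = [:: _; _; X; _; _; _; _]]add0n.
  rewrite -[X in _ = [:: _; _; _; X; _; _; _]]add0n.
  suff E m n : iter m (fun s => run (Seq (Inc 2) (Inc 3))
      (set_nth 0 s 0 (nth 0 s 0).-1)) [:: m; 0; n; n; 0; 0; 0] =
      [:: 0; 0; n + m; n + m; 0; 0; 0] by exact: E.
  elim: m n => [|m IHm] n; first by rewrite addn0.
  by rewrite iterSr IHm !addnS.
rewrite run_add4 add0n.
have -> : run (Loop 3 (wrap_cmd [:: 1] [:: 1; one])) [:: 0; 0; x; x; base; 0; 0]
    = [:: 0; 0; x; 0; l; 0; 0].
  rewrite run_loop [nth 0 _ _]/= /l.
  suff E m c : iter m (fun s => run (wrap_cmd [:: 1] [:: 1; one])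
      (set_nth 0 s 3 (nth 0 s 3).-1)) [:: 0; 0; x; m; c; 0; 0] =
      [:: 0; 0; x; 0; iter m (fun l => CodeSeq.code [:: 1; l; 1; one]) c; 0; 0]
    by exact: E.
  elim: m c => // m IHm c; rewrite [in RHS]iterSr iterSr.
  by rewrite [set_nth _ _ _ _]/= run_wrap IHm.
rewrite !run_wrap !cat1s cats1 [rcons _ _]/=.
set a := CodeSeq.code [:: 0; _; _].
have -> : run (Loop 2 (Inc 5)) [:: 0; 0; x; 0; a; 0; 0] =
    [:: 0; 0; 0; 0; a; x; 0].
  rewrite run_loop [nth 0 _ _]/=.
  suff E m n : iter m (fun s => run (Inc 5) (set_nth 0 s 2 (nth 0 s 2).-1))
     [:: 0; 0; m; 0; a; n; 0] = [:: 0; 0; 0; 0; a; n + m; 0] by exact: E.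
  elim: m n => [|m IHm] n; first by rewrite addn0.
  by rewrite iterSr IHm addnS.
rewrite run_cons; move: (CodeSeq.code (a :: s)) => y.
rewrite run_loop [nth 0 _ _]/=.
suff E m n : iter m (fun s => run (Inc 0) (set_nth 0 s 5 (nth 0 s 5).-1))
   [:: n; 0; 0; 0; 0; m; 0] = [:: n + m; 0; 0; 0; 0; 0; 0] by exact: E.
elim: m n => [|m IHm] n; first by rewrite addn0.
by rewrite iterSr IHm addnS.
Qed.

Lemma add_const_ok (P : pred nat) i k : P i ->
  wf_cmd (add_const i k) && all P (cmd_regs (add_const i k)).
Proof. by move=> Pi; elim: k => //= k /andP[-> ->]; rewrite Pi. Qed.

Lemma wrap_cmd_ok pre suf :
  wf_cmd (wrap_cmd pre suf) &&
  all (mem [:: 4; 5; 6]) (cmd_regs (wrap_cmd pre suf)).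
Proof.
have ok i k : i \in [:: 4; 5] -> wf_cmd (add_const i k) &&
    all (mem [:: 4; 5; 6]) (cmd_regs (add_const i k)).
  by move=> i45; apply: add_const_ok; move: i45; rewrite !inE => /orP[]/eqP->.
have /andP[wf5 all5] := ok 5 (CodeSeq.code suf) isT.
have [wfb allb] : wf_cmd (foldr (fun n c =>
      Seq c (Seq (add_const 4 n) cons_cmd)) Skip pre) /\
    all (mem [:: 4; 5; 6]) (cmd_regs (foldr (fun n c =>
      Seq c (Seq (add_const 4 n) cons_cmd)) Skip pre)).
  elim: pre => // n pre [wfp allp]; have /andP[wf4 all4] := ok 4 n isT.
  by rewrite [foldr _ _ _]/= /= !all_cat wfp wf4 allp all4.
by rewrite /wrap_cmd /= !all_cat /= wf5 wfb /= all5 all_cat allb.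
Qed.

Lemma input_cmd_ok base one root reg0 :
  wf_cmd (input_cmd base one root reg0) &&
  (1 \notin cmd_regs (input_cmd base one root reg0)).
Proof.
have /andP[wf4 all4] := @add_const_ok (predC1 1) 4 base isT.
have ok pre suf i : i \notin [:: 4; 5; 6] ->
    wf_cmd (wrap_cmd pre suf) && (i \notin cmd_regs (wrap_cmd pre suf)).
  move=> i456; have /andP[-> /allP sub] := wrap_cmd_ok pre suf.
  by apply: contra i456 => /sub.
have not4 : 1 \notin cmd_regs (add_const 4 base).
  by apply/negP => /(allP all4).
rewrite /input_cmd.
have wfE c1 c2 : wf_cmd (Seq c1 c2) && (1 \notin cmd_regs (Seq c1 c2)) =
   (wf_cmd c1 && (1 \notin cmd_regs c1)) && (wf_cmd c2 && (1 \notin cmd_regs c2)).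
  by rewrite /= mem_cat negb_or andbACA.
rewrite 8!wfE wf4 not4 !ok // !andbT.
have /andP[wf3 not3] := ok [:: 1] [:: 1; one] 3 isT.
have /andP[_ not1] := ok [:: 1] [:: 1; one] 1 isT.
by apply/and4P; split=> //; exact: (introT andP (conj not3 wf3)).
Qed.

Definition tbox_cmd : cmd :=
  input_cmd (code_pexpr (PConst 0)) (code_sterm (SConcept CRoot))
            (code_concept CRoot) (code_pexpr (reg_expr false false 0)).

Lemma code_numeral x :
  code_pexpr (numeral x) =
  iter x (fun l => CodeSeq.code [:: 1; l; 1; code_sterm (SConcept CRoot)])
    (code_pexpr (PConst 0)).
Proof. by elim: x => // x IHx; rewrite iterS -IHx. Qed.

Lemma run_tbox_cmd T : let x := code_tbox T in
  run tbox_cmd [:: x; 0; 0; 0; 0; 0; 0] =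
  [:: code_tbox (input_axiom x :: T); 0; 0; 0; 0; 0; 0].
Proof.
by move=> x; rewrite /tbox_cmd run_input -code_numeral.
Qed.

(* [c] stays abstract: for a concrete [c], tactics would unfold [compile] and the
   huge constants in the program. *)
Lemma diagonal_undecidable c : wf_cmd c -> 1 \notin cmd_regs c ->
    (forall T, let x := code_tbox T in
      run c [:: x; 0; 0; 0; 0; 0; 0] =
      [:: code_tbox (input_axiom x :: T); 0; 0; 0; 0; 0; 0]) ->
  ~ decidable_on code_tbox restricted consistent.
Proof.
move=> wfc not1 run_c [P decP].
pose p := compile 1 0 c; pose h := size p + size P.
pose Q := p ++ relocate (size p) P ++ [:: DecJump 0 h.+2].
have sizeQ : size Q = h.+1 by rewrite !size_cat size_map addnA addn1.
have [n n_gt0 Qn] := regs_lt_bound Q.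
pose T := program_axioms n Q.
(* Abstracted, so that no tactic tries to compute them. *)
have [x Ex] : exists x, x = code_tbox T by exists (code_tbox T).
have [y Ey] : exists y, y = code_tbox (input_axiom x :: T).
  by exists (code_tbox (input_axiom x :: T)).
have resU : restricted (input_axiom x :: T).
  apply/restricted_all/andP; split; first exact: restricted_input.
  exact: restricted_program.
have [b + consU] := decP _ resU; rewrite -Ey => -[k [haltP outP]].
pose r := (iter k (step P) (init y)).2.
have initE z : set_reg (fun=> 0) 0 z = nth 0 [:: z; 0; 0; 0; 0; 0; 0].
  apply/funext => i; rewrite /set_reg.
  by case: i => // i; do 7![case: i => // i].
have /reach_trans runQ : reach Q (init x) (size p, (init y).2).
  have := @compile_reach 1 c [::] (relocate (size p) P ++ [:: DecJump 0 h.+2])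
    [:: x; 0; 0; 0; 0; 0; 0] wfc not1 erefl.
  by rewrite {2}Ex run_c -Ex -Ey -!initE.
have := relocate_reach p P [:: DecJump 0 h.+2] k (init y).
rewrite /= min0n addn0 -/Q (minn_idPr haltP) => /runQ [l Ql].
have endQ : iter l.+1 (step Q) (init x) = (if b then h.+1 else h.+2,
   if b then set_reg r 0 0 else r).
  rewrite iterS Ql /= /Q catA -/h.
  have -> : h = size (p ++ relocate (size p) P) by rewrite size_cat size_map.
  rewrite onth_size_cat outP; by case: (b).
case: b consU endQ {outP} => consU endQ.
  apply: (consistent_run n_gt0 Qn (consU.1 isT) (k := l.+1)).
  by rewrite endQ sizeQ.
suff : consistent (input_axiom x :: T) by move/consU.
by apply: (@halt_consistent n Q x l.+1); rewrite endQ sizeQ.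
Qed.

Theorem theorem6 : ~ decidable_on code_tbox restricted consistent.
Proof.
have /andP[wf not1] := input_cmd_ok (code_pexpr (PConst 0))
  (code_sterm (SConcept CRoot)) (code_concept CRoot)
  (code_pexpr (reg_expr false false 0)).
exact: diagonal_undecidable wf not1 run_tbox_cmd.
Qed.
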